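(* (Reduction Lemma) Let $G_0$ be an acyclic graph on the vertex set $[n+1]$ with $d$ edges, and let $(i,j),(j,k)\in E(G_0)$ for some $i<j<k$. Let $G_1,G_2,G_3$ be the graphs on $[n+1]$ with edge sets $$E(G_1)=E(G_0)\setminus\{(j,k)\}\cup\{(i,k)\},$$ $$E(G_2)=E(G_0)\setminus\{(i,j)\}\cup\{(i,k)\},$$ $$E(G_3)=E(G_0)\setminus\{(i,j)\}\setminus\{(j,k)\}\cup\{(i,k)\}.$$ Then $G_1,G_2,G_3$ are acyclic, $$\mathcal{P}(G_0)=\mathcal{P}(G_1)\cup\mathcal{P}(G_2),$$ where all polytopes $\mathcal{P}(G_0),\mathcal{P}(G_1),\mathcal{P}(G_2)$ are $d$-dimensional, and $$\mathcal{P}(G_3)=\mathcal{P}(G_1)\cap\mathcal{P}(G_2)$$ is $(d-1)$-dimensional.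
   Context: $[n+1]=\{1,\ldots,n+1\}$; an edge joining $i<j$ is written $(i,j)$. Let $e_1,\ldots,e_{n+1}$ be the coordinate vectors of $\mathbb{R}^{n+1}$. $\mathcal{P}(A_n^+)$ is the convex hull of the origin and the points $e_i-e_j$, $1\le i<j\le n+1$. For a graph $G$ on $[n+1]$, $\mathcal{C}(G)$ is the cone of nonnegative linear combinations of the vectors $e_i-e_j$ with $(i,j)\in E(G)$, $i<j$, and $\mathcal{P}(G)=\mathcal{P}(A_n^+)\cap\mathcal{C}(G)$ (equivalently, the convex hull of the origin and all $e_i-e_j$, $i<j$, lying in $\mathcal{C}(G)$). *)

(* Defs.v *)
From mathcomp Require Import all_boot all_order all_algebra.
From mathcomp Require Import boolp classical_sets reals.

Set Implicit Arguments.
Unset Strict Implicit.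
Unset Printing Implicit Defensive.

Import GRing.Theory Num.Theory.

Local Open Scope classical_set_scope.
Local Open Scope ring_scope.

(** Simple graphs on the vertex set [{1, ..., n+1}], represented by the ordered
    type ['I_n.+1] (so vertices are numbered from 0). An undirected edge is
    stored once, as its pair of endpoints in increasing order; this makes every
    set of edges a simple graph. *)
Notation edge n := {e : 'I_n.+1 * 'I_n.+1 | (e.1 < e.2)%N}.

Notation graph n := {set edge n}.

Definition Edge n (i j : 'I_n.+1) (ij : (i < j)%N) : edge n :=
  exist (fun e : 'I_n.+1 * 'I_n.+1 => (e.1 < e.2)%N) (i, j) ij.

Definition adj n (G : graph n) : rel 'I_n.+1 :=
  fun x y => [exists e in G, (val e == (x, y)) || (val e == (y, x))].

(** The bound on the size discards the closed walks [[:: x]] and [[:: x; y]],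
    the latter going back and forth along one edge. *)
Definition acyclic n (G : graph n) : Prop :=
  forall c : seq 'I_n.+1, (2 < size c)%N -> ~ ucycle (adj G) c.

Section Hulls.
Variables (R : realType) (V : lmodType R).
Implicit Type A : set V.

Definition affine_hull A : set V :=
  [set x | exists (m : nat) (p : 'I_m -> V) (c : 'I_m -> R),
    [/\ forall t, A (p t), \sum_t c t = 1 & x = \sum_t c t *: p t]].

Definition convex_hull A : set V :=
  [set x | exists (m : nat) (p : 'I_m -> V) (c : 'I_m -> R),
    [/\ forall t, A (p t), forall t, 0 <= c t, \sum_t c t = 1
      & x = \sum_t c t *: p t]].

End Hulls.

(** [A] has dimension [d]: its affine hull is a translate of a [d]-dimensional
    linear subspace. The empty set has no dimension in this sense. *)
Definition has_dim (R : realType) (V : vectType R) (A : set V) (d : nat) : Prop :=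
  exists (p : V) (U : {vspace V}),
    affine_hull A = [set p + u | u in [set` U]] /\ \dim U = d.

Section RootPolytopes.
Variables (R : realType) (n : nat).

Definition coord_vec (i : 'I_n.+1) : 'rV[R]_n.+1 := delta_mx 0 i.

Definition edge_vec (e : edge n) : 'rV[R]_n.+1 :=
  coord_vec (val e).1 - coord_vec (val e).2.

Definition full_root_polytope : set 'rV[R]_n.+1 :=
  convex_hull ([set 0] `|` range edge_vec).

Definition root_cone (G : graph n) : set 'rV[R]_n.+1 :=
  [set x | exists c : edge n -> R,
    (forall e, e \in G -> 0 <= c e) /\ x = \sum_(e in G) c e *: edge_vec e].

Definition root_polytope (G : graph n) : set 'rV[R]_n.+1 :=
  full_root_polytope `&` root_cone G.

End RootPolytopes.

Arguments root_polytope R {n} G.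

(* Main.v *)
(** Every edge of an acyclic graph is a bridge, so the indicator function of one
    side of the bridge gives a linear form taking the value 1 on this edge and
    0 on the others: the edge vectors have a dual family. Conversely, the
    existence of a dual family forbids cycles, because the potential dual to an
    edge of a cycle would be constant along the rest of the cycle. If [fa] and
    [fb] are dual to [(i,j)] and [(j,k)], then replacing [(j,k)] by [(i,k)]
    amounts to replacing [fa], [fb] by [fa - fb], [fb]. On the cone of [G0],
    the cones of [G1], [G2] and [G3] are cut out by [fb <= fa], [fa <= fb] and
    [fa = fb] respectively. *)

Require Import Defs.
From mathcomp Require Import all_boot all_order all_algebra.
From mathcomp Require Import boolp classical_sets reals.

Set Implicit Arguments.
Unset Strict Implicit.
Unset Printing Implicit Defensive.

Import Order.TTheory GRing.Theory Num.Theory.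

Local Open Scope classical_set_scope.
Local Open Scope ring_scope.

(** * Bridges of acyclic graphs *)

Section Graphs.
Variable n : nat.
Implicit Types (G H : graph n) (e : edge n) (x y : 'I_n.+1).

Lemma adjP G x y :
  reflect (exists2 e, e \in G & val e = (x, y) \/ val e = (y, x)) (adj G x y).
Proof.
apply: (iffP exists_inP) => -[e eG h]; exists e => //.
  by case/orP: h => /eqP; [left | right].
by case: h => ->; rewrite eqxx ?orbT.
Qed.

Lemma adj_sym G : symmetric (adj G).
Proof. by move=> x y; apply/adjP/adjP => -[e eG h]; exists e => //; case: h; auto. Qed.

Lemma adj_edge G e : e \in G -> adj G (val e).1 (val e).2.
Proof. by move=> eG; apply/adjP; exists e => //; left; case: (val e). Qed.

Lemma adj_sub G H : G \subset H -> subrel (adj G) (adj H).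
Proof. by move=> /fintype.subsetP GH x y /adjP[e /GH eH h]; apply/adjP; exists e. Qed.

(** A simple path joining the endpoints of [e] and avoiding [e] would close up to a cycle. *)
Lemma acyclic_bridge G e :
  acyclic G -> e \in G -> ~~ connect (adj (G :\ e)) (val e).1 (val e).2.
Proof.
move=> Gac eG; apply/negP => /connectP[p0 p0P].
case/shortenP: p0P => p pP up _ lastp.
have lt12 : ((val e).1 < (val e).2)%N by apply: (valP e).
apply: (Gac ((val e).1 :: p)); last first.
  rewrite /ucycle up andbT /= rcons_path -lastp adj_sym adj_edge // andbT.
  by apply: sub_path pP; apply: adj_sub; apply: subD1set.
(* The cycle has at least three vertices: an empty path would identify the endpoints, and a single
   step would be [e] itself. *)
case: p pP lastp {up p0} => [|y [|z p]] //=.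
  by move=> _ eq12; rewrite eq12 ltnn in lt12.
rewrite andbT => /adjP[e' /setD1P[ne _] [] ve'] ey.
  by rewrite -ey -surjective_pairing in ve'; rewrite (val_inj ve') eqxx in ne.
by have := valP e'; rewrite ve' /= -ey ltnNge ltnW.
Qed.

End Graphs.

(** Since [A] contains 0, a linear combination becomes affine by putting the missing weight
    [1 - \sum_i c i] on 0, here at index [ord0]. *)
Lemma affine_hull_span (R : realType) (V : vectType R) (A : set V) m
    (X : m.-tuple V) :
  A 0 -> (forall i : 'I_m, A X`_i) -> A `<=` [set` <<X>>%VS] ->
  affine_hull A = [set` <<X>>%VS].
Proof.
move=> A0 AX AsX; apply/seteqP; split=> x /=.
  move=> [l [p [c [Ap _ ->]]]]; apply: memv_suml => t _.
  by apply/memvZ/AsX/Ap.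
move=> /coord_span xE.
pose c := coord X ^~ x.
exists m.+1, (fun t => if unlift ord0 t is Some i then X`_i else 0),
  (fun t => if unlift ord0 t is Some i then c i else 1 - \sum_i c i); split.
- by move=> t; case: unliftP.
- rewrite big_ord_recl unlift_none; under [X in _ + X]eq_bigr do rewrite liftK.
  by rewrite subrK.
- rewrite big_ord_recl unlift_none scaler0 add0r.
  by under eq_bigr do rewrite liftK.
Qed.

(** * Dual families, independence of the edge vectors, dimension *)

Section DualFamily.
Variables (R : realType) (n : nat).
Implicit Types (G H : graph n) (e : edge n).
Local Notation v := (edge_vec R).

(** Columns act as linear forms on row vectors, so the Kronecker delta appears as a 1 by 1
    matrix. *)
Definition dual_family G (f : edge n -> 'cV[R]_n.+1) :=
  {in G &, forall e e', v e *m f e' = (e == e')%:R%:M}.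

Lemma edge_vec_mulE e (f : 'cV[R]_n.+1) :
  v e *m f = (f (val e).1 0 - f (val e).2 0)%:M.
Proof.
rewrite /edge_vec /coord_vec mulmxBl -!rowE.
by apply/matrixP => a b; rewrite !ord1 !mxE eqxx.
Qed.

Lemma acyclic_dual G : acyclic G -> exists f, dual_family G f.
Proof.
move=> Gac.
exists (fun e => \col_x (connect (adj (G :\ e)) (val e).1 x)%:R) => e e' eG e'G.
rewrite edge_vec_mulE !mxE; case: eqP => [-> | /eqP ne].
  by rewrite connect0 (negbTE (acyclic_bridge Gac e'G)) subr0.
(* [e] survives in [G :\ e'], so its endpoints lie in the same component. *)
rewrite (same_connect_r (sym_connect_sym (@adj_sym _ _)) (y := (val e).2)).
  by rewrite subrr.
by apply/connect1/adj_edge/setD1P.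
Qed.

Lemma dual_acyclic G f : dual_family G f -> acyclic G.
Proof.
move=> fP [|x [|y [|z c]]] //= _ /andP[/= /and3P[]].
move=> /adjP[e eG ve] yz zcx /and4P[]; rewrite !inE !negb_or.
case/and3P=> xy xz xc /andP[yz' yc] _ _.
pose phi w := f e w 0.
have const u w : adj G u w -> (u, w) != (x, y) -> (u, w) != (y, x) -> phi u = phi w.
  move=> /adjP[e' e'G ve'] ne1 ne2; have := fP e' e e'G eG.
  rewrite edge_vec_mulE.
  have /negbTE-> : e' != e.
    apply: contraNneq ne1 => ee'; move: ve' ne2; rewrite ee'.
    by case: ve => -> [] [-> ->]; rewrite ?eqxx.
  move=> /matrixP/(_ 0 0); rewrite !mxE eqxx !mulr1n => /eqP; rewrite subr_eq0.
  by rewrite /phi => /eqP; case: ve' => -> /=.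
(* As [x], [y], [z] are distinct, the edge from [y] to [z] is not [e]. *)
have phiyz : phi y = phi z.
  by apply: const; rewrite // xpair_eqE negb_and ?(eq_sym z) ?xz ?(eq_sym y) ?xy ?orbT.
(* The rest of the cycle avoids [y], hence never uses the edge [e] again. *)
have phi_path s u : path (adj G) u s -> y \notin u :: s -> phi u = phi (last u s).
  elim: s u => //= w s IHs u /andP[uw ws]; rewrite in_cons negb_or.
  move=> /andP[yu yws]; rewrite -(IHs _ ws yws).
  move: yws; rewrite in_cons negb_or => /andP[yw _].
  apply: const; rewrite // xpair_eqE negb_and; first by rewrite (eq_sym w) yw orbT.
  by rewrite (eq_sym u) yu.
have := phi_path _ _ zcx; rewrite last_rcons !inE mem_rcons inE !negb_or.
rewrite yz' eq_sym xy yc => /(_ isT) phizx.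
have /matrixP/(_ 0 0) := fP e e eG eG; rewrite edge_vec_mulE !mxE !eqxx !mulr1n.
have phixy : phi x = phi y by rewrite phiyz.
move/eqP; case: ve => -> /=; rewrite -/(phi x) -/(phi y) phixy subrr;
  by rewrite eq_sym oner_eq0.
Qed.

Lemma dual_familyS G H f : H \subset G -> dual_family G f -> dual_family H f.
Proof. by move=> /fintype.subsetP HG fP e e' /HG eG /HG e'G; apply: fP. Qed.

(** Used to peel off [a], [b], [h] one by one, so that cone membership becomes a statement on their
    coefficients. *)
Lemma root_coneU1 G e (x : 'rV[R]_n.+1) : e \notin G ->
  root_cone (e |: G) x <->
  exists (a : R) (y : 'rV[R]_n.+1), [/\ 0 <= a, root_cone G y & x = a *: v e + y].
Proof.
move=> eG; split=> [[c [c0 ->]] | [a [y [a0 [c [c0 ->]] ->]]]].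
  exists (c e), (\sum_(e' in G) c e' *: v e'); split; first exact/c0/setU11.
    by exists c; split=> // e' e'G; apply: c0; rewrite setU1r.
  by rewrite big_setU1.
exists (fun e' => if e' == e then a else c e'); split=> [e' |].
  by rewrite in_setU1; case: eqP => //= _ /c0.
rewrite big_setU1 //= eqxx; congr (_ + _); apply: eq_bigr => e' e'G.
by case: eqP => // ee'; rewrite -ee' e'G in eG.
Qed.

Lemma edge_vec_full e : full_root_polytope (v e).
Proof.
exists 1%N, (fun=> v e), (fun=> 1); split=> //.
- by move=> _; right; exists e.
- by rewrite big_ord1.
- by rewrite big_ord1 scale1r.
Qed.

Lemma root_polytope0 G : root_polytope R G 0.
Proof.
split; last by exists (fun=> 0); split=> //; rewrite big1 // => e _; rewrite scale0r.
exists 1%N, (fun=> 0), (fun=> 1); split=> //; first by left.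
  by rewrite big_ord1.
by rewrite big_ord1 scaler0.
Qed.

Lemma root_polytope_edge G e : e \in G -> root_polytope R G (v e).
Proof.
move=> eG; split; first exact: edge_vec_full.
exists (fun e' => (e' == e)%:R); split=> //.
rewrite (big_setD1 e) //= eqxx scale1r big1 ?addr0 // => e' /setD1P[/negbTE-> _].
by rewrite scale0r.
Qed.

Definition edge_tuple G : #|G|.-tuple 'rV[R]_n.+1 :=
  [tuple v (enum_val t) | t < #|G|].

Lemma edge_tuple_nth G (t : 'I_#|G|) : (edge_tuple G)`_t = v (enum_val t).
Proof. by rewrite -tnth_nth tnth_mktuple. Qed.

(** Applying the form dual to an edge to a vanishing combination isolates the coefficient of that
    edge. *)
Lemma edge_tuple_free G f : dual_family G f -> free (edge_tuple G).
Proof.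
move=> fP; apply/freeP => c c0 t.
have /(congr1 (mulmx^~ (f (enum_val t)))) := c0; rewrite mul0mx mulmx_suml.
rewrite (bigD1 t) //= big1 ?addr0 => [|u ut].
  rewrite edge_tuple_nth -scalemxAl fP ?enum_valP // eqxx => /matrixP/(_ 0 0).
  by rewrite !mxE eqxx mulr1.
rewrite edge_tuple_nth -scalemxAl fP ?enum_valP // (inj_eq enum_val_inj) (negbTE ut).
by rewrite raddf0 scaler0.
Qed.

(** The polytope contains 0 and the edge vectors of [G] and lies in their span, so its affine hull
    is this span, of which they form a basis. *)
Lemma has_dim_root_polytope G : acyclic G -> has_dim (root_polytope R G) #|G|.
Proof.
move=> /acyclic_dual[f /edge_tuple_free Gfree].
exists 0, <<edge_tuple G>>%VS; split; last first.
  by rewrite (eqP Gfree) size_tuple.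
rewrite (@affine_hull_span _ _ _ _ (edge_tuple G)).
- apply/seteqP; split=> x /=; first by exists x; rewrite ?add0r.
  by case=> y ? <-; rewrite add0r.
- exact: root_polytope0.
- by move=> t; rewrite edge_tuple_nth; apply/root_polytope_edge/enum_valP.
- move=> x [_ [c [_ ->]]] /=; apply: memv_suml => e eG.
  rewrite memvZ // memv_span //; apply/(@tnthP _ _ (edge_tuple G)).
  exists (enum_rank_in eG e).
  by rewrite tnth_mktuple enum_rankK_in.
Qed.

End DualFamily.

(** * Replacing [b] by [h], where [v h = v a + v b] *)

Section Reduction.
Variables (R : realType) (n : nat) (S : graph n) (a b h : edge n).
Hypotheses (aS : a \notin S) (bS : b \notin S) (hS : h \notin S).
Hypotheses (ab : a != b) (ah : a != h).
Local Notation v := (edge_vec R).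
Hypothesis vh : v h = v a + v b.

Let aS' : a \notin b |: S.
Proof. by rewrite !inE negb_or ab. Qed.

Let hS' : h \notin a |: S.
Proof. by rewrite !inE negb_or eq_sym ah. Qed.

(** On [h] the form [f b] is 1 and [f a - f b] is 1 - 1 = 0; the forms dual to edges of [S] vanish
    on [a] and [b], hence on [h]. *)
Lemma reduction_dual (f : edge n -> 'cV[R]_n.+1) : dual_family (a |: (b |: S)) f ->
  dual_family (h |: (a |: S))
    (fun e => if e == h then f b else if e == a then f a - f b else f e : 'cV[R]_n.+1).
Proof.
move=> fP.
have aP : a \in a |: (b |: S) by rewrite !inE eqxx.
have bP : b \in a |: (b |: S) by rewrite !inE eqxx orbT.
have sP e : e \in S -> e \in a |: (b |: S) by rewrite !inE => ->; rewrite !orbT.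
have neS e s : e \notin S -> s \in S -> (e == s = false) * (s == e = false).
  by move=> eS sS; rewrite (eq_sym s); split; apply: contraNF eS => /eqP->.
have naS s := neS _ s aS; have nbS s := neS _ s bS; have nhS s := neS _ s hS.
have nab : (a == b = false) * (b == a = false) by rewrite (eq_sym b) (negbTE ab).
have nah : (a == h = false) * (h == a = false) by rewrite (eq_sym h) (negbTE ah).
have fE := (fP _ _ aP aP, fP _ _ aP bP, fP _ _ bP aP, fP _ _ bP bP).
(* Repeated rewriting with [mulmxDl] would also distribute over the difference
   hidden in [edge_vec]. *)
have vhE (w : 'cV_n.+1) : v h *m w = v a *m w + v b *m w by rewrite vh mulmxDl.
move=> e e' /setU1P[->|/setU1P[->|eS]] /setU1P[->|/setU1P[->|e'S]];
  rewrite ?vhE ?eqxx ?nah ?naS ?nhS // ?mulmxBr ?fE ?fP // ?sP // ?eqxx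
    ?nab ?naS ?nbS // ?raddf0 ?subr0 ?add0r ?addr0 //.
by rewrite subrr.
Qed.

Lemma reduction_cone_sub :
  root_cone (R := R) (h |: (a |: S)) `<=` root_cone (a |: (b |: S)).
Proof.
move=> _ /(root_coneU1 _ hS')[c [_ [c0 /(root_coneU1 _ aS)[d [y [d0 yS ->]]] ->]]].
apply/(root_coneU1 _ aS'); exists (c + d), (c *: v b + y); split.
- exact: addr_ge0.
- by apply/(root_coneU1 _ bS); exists c, y.
- rewrite vh; move: (v a) (v b) => va vb.
  by rewrite scalerDr scalerDl addrACA.
Qed.

(** An amount [d] of both [a] and [b] merges into [h]; the rest [c - d] stays on [a]. *)
Lemma reduction_cone_mem c d (y : 'rV[R]_n.+1) : 0 <= d -> d <= c ->
  root_cone S y -> root_cone (h |: (a |: S)) (c *: v a + (d *: v b + y)).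
Proof.
move=> d0 dc yS; apply/(root_coneU1 _ hS'); exists d, ((c - d) *: v a + y).
split=> //; first by apply/(root_coneU1 _ aS); exists (c - d), y; rewrite subr_ge0.
rewrite vh; move: (v a) (v b) => va vb.
by rewrite scalerDr addrACA -scalerDl [d + _]addrC subrK.
Qed.

End Reduction.

(** * Union and intersection of the two cones *)

Section ReductionPair.
Variables (R : realType) (n : nat) (S : graph n) (a b h : edge n).
Hypotheses (aS : a \notin S) (bS : b \notin S) (hS : h \notin S).
Hypotheses (ab : a != b) (ah : a != h) (bh : b != h).
Local Notation v := (edge_vec R).
Hypothesis vh : v h = v a + v b.

Lemma reduction_cone_union :
  root_cone (R := R) (a |: (b |: S)) =
  root_cone (h |: (a |: S)) `|` root_cone (h |: (b |: S)).
Proof.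
have ba : b != a by rewrite eq_sym.
have vh' : v h = v b + v a by rewrite addrC.
have aS' : a \notin b |: S by rewrite !inE negb_or ab.
apply/seteqP; split=> [_ /(root_coneU1 _ aS')
  [c [_ [c0 /(root_coneU1 _ bS)[d [y [d0 yS ->]]] ->]]] | x []].
(* The smaller coefficient is absorbed into [h]; the second case exchanges [a] and [b]. *)
- have [dc|/ltW cd] := leP d c; [left|right]; first exact: reduction_cone_mem.
  by rewrite addrCA; apply: reduction_cone_mem.
- exact: reduction_cone_sub.
- by rewrite [a |: _]finset.setUCA; apply: reduction_cone_sub.
Qed.

(** The form [f a - f b] vanishes on [h] and on the cone of [S]. On a common point it gives [p >= 0]
    from the first cone and [- q <= 0] from the second, so [p = 0] and [a] drops out. *)
Lemma reduction_cone_inter (f : edge n -> 'cV[R]_n.+1) :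
  dual_family (a |: (b |: S)) f ->
  root_cone (R := R) (h |: S) =
  root_cone (h |: (a |: S)) `&` root_cone (h |: (b |: S)).
Proof.
move=> fP.
have haS : h \notin a |: S by rewrite !inE negb_or eq_sym ah.
have hbS : h \notin b |: S by rewrite !inE negb_or eq_sym bh.
apply/seteqP; split=> [_ /(root_coneU1 _ hS)[c [y [c0 yS ->]]] | x [/=]].
  split; [apply/(root_coneU1 _ haS) | apply/(root_coneU1 _ hbS)];
    exists c, y; split=> //; [apply/(root_coneU1 _ aS) | apply/(root_coneU1 _ bS)];
    by exists 0, y; rewrite scale0r add0r.
move=> /(root_coneU1 _ haS)[c [_ [c0 /(root_coneU1 _ aS)[p [y [p0 yS ->]]] ->]]].
move=> /(root_coneU1 _ hbS)[c' [_ [_ /(root_coneU1 _ bS)[q [y' [q0 y'S ->]]]]]].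
have aP : a \in a |: (b |: S) by rewrite !inE eqxx.
have bP : b \in a |: (b |: S) by rewrite !inE eqxx orbT.
have fE := (fP _ _ aP aP, fP _ _ aP bP, fP _ _ bP aP, fP _ _ bP bP).
have fS z : root_cone S z -> z *m (f a - f b) = 0.
  move=> [w [_ ->]]; rewrite mulmx_suml big1 // => e eS.
  have eP : e \in a |: (b |: S) by rewrite !inE eS !orbT.
  rewrite -scalemxAl mulmxBr !fP //.
  have /negbTE-> : e != a by apply: contraNneq aS => <-.
  have /negbTE-> : e != b by apply: contraNneq bS => <-.
  by rewrite subrr scaler0.
have vaE : v a *m (f a - f b) = 1%:M.
  by rewrite mulmxBr !fE eqxx (negbTE ab) raddf0 subr0.
have vbE : v b *m (f a - f b) = - 1%:M.
  by rewrite mulmxBr !fE eqxx (eq_sym b) (negbTE ab) raddf0 sub0r.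
rewrite vh => eq_x; have {eq_x} pq : p = - q.
  move: (v a) (v b) vaE vbE eq_x => va vb vaE vbE.
  move=> /(congr1 (mulmx^~ (f a - f b))).
  rewrite !(mulmxDl, =^~ scalemxAl) vaE vbE !fS // subrr !scaler0 !add0r !addr0.
  by move=> /matrixP/(_ 0 0); rewrite !mxE eqxx mulr1 mulrN1.
rewrite -vh.
have -> : p = 0 by apply/le_anti; rewrite p0 pq oppr_le0 q0.
by rewrite scale0r add0r; apply/(root_coneU1 _ hS); exists c, y.
Qed.

End ReductionPair.

(** * From cones to polytopes *)

Theorem lemma5 (R : realType) (n d : nat) (G0 : graph n)
    (G0_acyclic : acyclic G0) (G0_edges : #|G0| = d)
    (i j k : 'I_n.+1) (ij : (i < j)%N) (jk : (j < k)%N)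
    (ij_G0 : Edge ij \in G0) (jk_G0 : Edge jk \in G0) :
  let ik : (i < k)%N := ltn_trans ij jk in
  let G1 : graph n := (G0 :\ Edge jk) :|: [set Edge ik]%SET in
  let G2 : graph n := (G0 :\ Edge ij) :|: [set Edge ik]%SET in
  let G3 : graph n := (G0 :\ Edge ij :\ Edge jk) :|: [set Edge ik]%SET in
  [/\ acyclic G1, acyclic G2 & acyclic G3] /\
  root_polytope R G0 = root_polytope R G1 `|` root_polytope R G2 /\
  [/\ has_dim (root_polytope R G0) d,
      has_dim (root_polytope R G1) d
    & has_dim (root_polytope R G2) d] /\
  root_polytope R G3 = root_polytope R G1 `&` root_polytope R G2 /\
  has_dim (root_polytope R G3) d.-1.
Proof.
move=> ik G1 G2 G3.
set a := Edge ij in G2 G3 ij_G0 *; set b := Edge jk in G1 G3 jk_G0 *.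
set h := Edge ik in G1 G2 G3 *.
have vh : edge_vec R h = edge_vec R a + edge_vec R b.
  by rewrite /edge_vec /= addrA subrK.
have neE (x y x' y' : 'I_n.+1) (xy : (x < y)%N) (x'y' : (x' < y')%N) :
    ((x : nat) != x') || ((y : nat) != y') -> Edge xy != Edge x'y'.
  by apply: contraTneq => -[-> ->]; rewrite !eqxx.
have ab : a != b by apply: neE; rewrite ltn_eqF.
have ah : a != h by apply: neE; rewrite (ltn_eqF jk) orbT.
have bh : b != h by apply: neE; rewrite (gtn_eqF ij).
have [f fP] := acyclic_dual R G0_acyclic.
(* Otherwise the form dual to [a] would be 1 on [v h = v a + v b], although [h] is not [a]. *)
have hG0 : h \notin G0.
  apply/negP => hG0; have := fP _ _ hG0 ij_G0.
  rewrite vh mulmxDl !fP // eqxx !(eq_sym _ a) (negbTE ab) (negbTE ah) raddf0 addr0.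
  by move=> /matrixP/(_ 0 0)/eqP; rewrite !mxE oner_eq0.
(* [S] is the part shared by all four graphs. *)
pose S := G0 :\ a :\ b.
have aS : a \notin S by rewrite !inE eqxx andbF.
have bS : b \notin S by rewrite !inE eqxx.
have hS : h \notin S by rewrite !inE (negbTE hG0) !andbF.
have G0E : G0 = a |: (b |: S) by rewrite !finset.setD1K // !inE eq_sym ab.
have G3E : G3 = h |: S by rewrite /G3 finset.setUC.
clearbody S.
have G1E : G1 = h |: (a |: S).
  by rewrite /G1 finset.setUC G0E finset.setUCA finset.setU1K // !inE negb_or eq_sym ab.
have G2E : G2 = h |: (b |: S).
  by rewrite /G2 finset.setUC G0E finset.setU1K // !inE negb_or ab.
have [f1 G1f] : exists f1, dual_family (R := R) G1 f1.
  rewrite G1E; eexists; apply: (reduction_dual aS bS hS ab ah vh).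
  by rewrite -G0E; exact: fP.
have [f2 G2f] : exists f2, dual_family (R := R) G2 f2.
  have [ba vh'] : b != a /\ edge_vec R h = edge_vec R b + edge_vec R a.
    by rewrite eq_sym addrC.
  rewrite G2E; eexists; apply: (reduction_dual bS aS hS ba bh vh').
  by rewrite finset.setUCA -G0E; exact: fP.
have G1_acyclic := dual_acyclic G1f.
have G2_acyclic := dual_acyclic G2f.
(* [G3] is contained in [G1] and inherits its dual family. *)
have G3_acyclic : acyclic G3.
  apply: (dual_acyclic (dual_familyS _ G1f)).
  by rewrite G1E G3E finset.setUS // finset.subsetUr.
have G0_card : #|a |: (b |: S)| = d by rewrite -G0E.
(* [G0] contains both [a] and [b], so [d >= 2] and [d.-1] is a true predecessor. *)
have G3_card : #|G3| = d.-1.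
  by rewrite -G0_card G3E !cardsU1 bS hS !inE negb_or ab aS.
have G1_card : #|G1| = d.
  by rewrite -G0_card G1E !cardsU1 aS bS !inE !negb_or ab aS eq_sym ah hS.
have G2_card : #|G2| = d.
  by rewrite -G0_card G2E !cardsU1 bS !inE !negb_or ab aS eq_sym bh hS.
split=> //; split.
  (* All the polytopes cut the same full root polytope by a cone, so identities between cones carry
     over. *)
  rewrite /root_polytope G0E G1E G2E.
  by rewrite (reduction_cone_union aS bS hS ab ah bh vh) setIUr.
split.
  by split; [rewrite -G0_edges | rewrite -G1_card | rewrite -G2_card];
    apply: has_dim_root_polytope.
split; last by rewrite -G3_card; apply: has_dim_root_polytope.
rewrite /root_polytope G1E G2E G3E; rewrite G0E in fP.
by rewrite (reduction_cone_inter aS bS hS ab ah bh vh fP) setIIr.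
Qed.
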